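(* For every finite group $G$, $$|\mathrm{Irr}(D(G))|=\sum_{[g]\subseteq G}k(C_G(g))=|G|^2P_3(G),$$ where the sum runs over the conjugacy classes $[g]$ of $G$.
   Context: $D(G)$ is the untwisted Drinfeld double of $G$ over $\mathbb C$: the $\mathbb C$-algebra $\mathbb C^G\rtimes\mathbb C G$ with underlying vector space $\mathbb C^G\otimes\mathbb C G$, with basis $\{\delta_g\otimes x: g,x\in G\}$ (where $\delta_g\in\mathbb C^G$ is the indicator function of $g$), and multiplication $$(\delta_g\otimes x)(\delta_h\otimes y)=\delta_{g,\,xhx^{-1}}\;(\delta_g\otimes xy),$$ where $\delta_{a,b}$ is the Kronecker delta. For a finite-dimensional $\mathbb C$-algebra $B$, $\mathrm{Irr}(B)$ is the set of isomorphism classes of simple $B$-modules. $k(H)$ is the number of conjugacy classes of a finite group $H$, $C_G(g)$ is the centralizer of $g$, and $P_3(G):=|\{(x_1,x_2,x_3)\in G^3: x_ix_j=x_jx_i\ \forall i,j\}|/|G|^3$. *)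

(* Defs.v *)
From HB Require Import structures.
From mathcomp Require Import all_boot all_order all_fingroup all_algebra all_field.

Set Implicit Arguments.
Unset Strict Implicit.
Unset Printing Implicit Defensive.

Import GRing.Theory.
Local Open Scope ring_scope.

(* An element of the double is its coordinate function: the value at (g, x)       *)
(* is the coefficient of delta_g tensor x. The library puts a pointwise product   *)
(* on {ffun _ -> F}; this alias only inherits the vector space structure.         *)
Definition drinfeld_double (F : fieldType) (gT : finGroupType) : Type :=
  {ffun gT * gT -> F^o}.

Section DrinfeldDouble.

Variables (F : fieldType) (gT : finGroupType).

Local Notation D := (drinfeld_double F gT).

HB.instance Definition _ := Vector.copy D {ffun gT * gT -> F^o}.

Definition dd_basis (g x : gT) : D := [ffun p => (p == (g, x))%:R].

Definition dd_basis_mul (g x h y : gT) : D :=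
  (g == x * h * x^-1)%g%:R *: dd_basis g (x * y)%g.

Definition dd_mul (u v : D) : D :=
  \sum_(p : gT * gT) \sum_(q : gT * gT)
     (u p * v q) *: dd_basis_mul p.1 p.2 q.1 q.2.

Definition dd_one : D := \sum_(g : gT) dd_basis g 1%g.

Lemma dd_basisE g x p : dd_basis g x p = (p == (g, x))%:R.
Proof. by rewrite ffunE. Qed.

Lemma dd_expand (u : D) : u = \sum_(p : gT * gT) u p *: dd_basis p.1 p.2.
Proof.
apply/ffunP=> q; rewrite sum_ffunE (bigD1 q) //= ffunE dd_basisE.
rewrite -surjective_pairing eqxx.
rewrite [_ *: _]mulr1 big1 ?addr0 // => p /negPf neq_pq.
by rewrite ffunE dd_basisE -surjective_pairing eq_sym neq_pq [_ *: _]mulr0.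
Qed.

Lemma dd_mulDl : left_distributive dd_mul +%R.
Proof.
move=> u v w; rewrite -big_split; apply: eq_bigr => p _.
rewrite -big_split; apply: eq_bigr => q _ /=.
by rewrite ffunE mulrDl scalerDl.
Qed.

Lemma dd_mulDr : right_distributive dd_mul +%R.
Proof.
move=> u v w; rewrite -big_split; apply: eq_bigr => p _.
rewrite -big_split; apply: eq_bigr => q _ /=.
by rewrite ffunE mulrDr scalerDl.
Qed.

Lemma dd_scaleAl (a : F) (u v : D) : a *: dd_mul u v = dd_mul (a *: u) v.
Proof.
rewrite scaler_sumr; apply: eq_bigr => p _.
rewrite scaler_sumr; apply: eq_bigr => q _ /=.
by rewrite ffunE scalerA -[a *: u p]/(a * u p) mulrA.
Qed.

Lemma dd_scaleAr (a : F) (u v : D) : a *: dd_mul u v = dd_mul u (a *: v).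
Proof.
rewrite scaler_sumr; apply: eq_bigr => p _.
rewrite scaler_sumr; apply: eq_bigr => q _ /=.
by rewrite ffunE scalerA -[a *: v q]/(a * v q) mulrCA.
Qed.

Lemma dd_mul0l (v : D) : dd_mul 0 v = 0.
Proof. by have:= dd_scaleAl 0 0 v; rewrite !scale0r. Qed.

Lemma dd_mul0r (u : D) : dd_mul u 0 = 0.
Proof. by have:= dd_scaleAr 0 u 0; rewrite !scale0r. Qed.

Lemma dd_mul_suml (I : finType) (f : I -> D) (v : D) :
  dd_mul (\sum_i f i) v = \sum_i dd_mul (f i) v.
Proof.
by elim/big_rec2: _ => [|i y1 y2 _ <-]; rewrite ?dd_mul0l ?dd_mulDl.
Qed.

Lemma dd_mul_sumr (I : finType) (f : I -> D) (u : D) :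
  dd_mul u (\sum_i f i) = \sum_i dd_mul u (f i).
Proof.
by elim/big_rec2: _ => [|i y1 y2 _ <-]; rewrite ?dd_mul0r ?dd_mulDr.
Qed.

Lemma dd_mul_basis g x h y :
  dd_mul (dd_basis g x) (dd_basis h y) = dd_basis_mul g x h y.
Proof.
rewrite /dd_mul (bigD1 (g, x)) //= (bigD1 (h, y)) //= !dd_basisE !eqxx mulr1.
rewrite scale1r big1 => [|q /negPf neq_q]; last first.
  by rewrite dd_basisE neq_q mulr0 scale0r.
rewrite addr0 big1 ?addr0 // => p /negPf neq_p; apply: big1 => q _.
by rewrite dd_basisE neq_p mul0r scale0r.
Qed.

Lemma dd_mulA : associative dd_mul.
Proof.
move=> u v w; rewrite (dd_expand u) (dd_mul_suml _ (dd_mul v w)).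
rewrite (dd_mul_suml _ v) (dd_mul_suml _ w); apply: eq_bigr => -[g x] _.
rewrite -(dd_scaleAl _ _ (dd_mul v w)) -(dd_scaleAl _ _ v) -(dd_scaleAl _ _ w).
congr (_ *: _) => /=.
rewrite (dd_expand v) (dd_mul_suml _ w) (dd_mul_sumr _ (dd_basis g x)).
rewrite (dd_mul_sumr _ (dd_basis g x)) (dd_mul_suml _ w).
apply: eq_bigr => -[h y] _ /=.
rewrite -(dd_scaleAl _ _ w) -(dd_scaleAr _ (dd_basis g x)).
rewrite -(dd_scaleAr _ (dd_basis g x)) -(dd_scaleAl _ _ w); congr (_ *: _).
rewrite (dd_expand w) (dd_mul_sumr _ (dd_basis h y)).
rewrite (dd_mul_sumr _ (dd_basis g x)) (dd_mul_sumr _ (dd_mul _ _)).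
apply: eq_bigr => -[k z] _ /=.
rewrite -(dd_scaleAr _ (dd_basis h y)) -(dd_scaleAr _ (dd_basis g x)).
rewrite -(dd_scaleAr _ (dd_mul _ _)); congr (_ *: _).
rewrite (dd_mul_basis h y) (dd_mul_basis g x) /dd_basis_mul.
rewrite -dd_scaleAr -dd_scaleAl !dd_mul_basis /dd_basis_mul !scalerA -!natrM.
rewrite !mulnb mulgA.
congr (_%:R *: _); congr nat_of_bool; apply/andP/andP=> [[/eqP-> /eqP->]|].
  by rewrite !invMg !mulgA !eqxx.
case=> /eqP def_g /eqP; rewrite def_g eqxx invMg -!mulgA => /mulgI.
by rewrite !mulgA => /mulIg ->; rewrite !eqxx.
Qed.

Lemma dd_mul1l : left_id dd_one dd_mul.
Proof.
move=> u; rewrite dd_mul_suml [in RHS](dd_expand u).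
rewrite {1}(dd_expand u).
under eq_bigr do rewrite dd_mul_sumr.
rewrite exchange_big; apply: eq_bigr => -[h y] _ /=.
rewrite (bigD1 h) //= -dd_scaleAr dd_mul_basis /dd_basis_mul.
rewrite mul1g invg1 mulg1 eqxx scale1r mul1g big1 ?addr0 // => g /negPf neq_g.
rewrite -dd_scaleAr dd_mul_basis /dd_basis_mul.
by rewrite mul1g invg1 mulg1 neq_g scale0r scaler0.
Qed.

Lemma dd_mul1r : right_id dd_one dd_mul.
Proof.
move=> u; rewrite {1}(dd_expand u) dd_mul_suml [in RHS](dd_expand u).
apply: eq_bigr => -[g x] _ /=; rewrite -dd_scaleAl; congr (_ *: _).
rewrite dd_mul_sumr (bigD1 (x^-1 * g * x)%g) //= dd_mul_basis /dd_basis_mul.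
rewrite !mulgA mulgV mul1g mulgK eqxx scale1r mulg1 big1 ?addr0 // => h neq_h.
rewrite dd_mul_basis /dd_basis_mul; case: eqP => [def_g|_]; last by rewrite scale0r.
by case/eqP: neq_h; rewrite def_g !mulgA mulVg mul1g mulgKV.
Qed.

Lemma dd_one_neq0 : dd_one != 0.
Proof.
apply/eqP=> /ffunP/(_ (1, 1)%g)/eqP; rewrite sum_ffunE (bigD1 1%g) //= big1.
  by rewrite dd_basisE eqxx addr0 ffunE oner_eq0.
by move=> g /negPf neq_g; rewrite dd_basisE xpair_eqE eq_sym neq_g.
Qed.

HB.instance Definition _ := GRing.Zmodule_isNzRing.Build D
  dd_mulA dd_mul1l dd_mul1r dd_mulDl dd_mulDr dd_one_neq0.
HB.instance Definition _ := GRing.Lmodule_isLalgebra.Build F D dd_scaleAl.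
HB.instance Definition _ := GRing.Lalgebra_isAlgebra.Build F D dd_scaleAr.
HB.instance Definition _ := Algebra_isFalgebra.Build F D.

Lemma dd_basisM g x h y : dd_basis g x * dd_basis h y =
  (g == x * h * x^-1)%g%:R *: dd_basis g (x * y)%g.
Proof. exact: dd_mul_basis. Qed.

End DrinfeldDouble.

Definition simple_module (B : nzRingType) (V : lmodType B) : Prop :=
  (exists v : V, v != 0) /\
  forall S : {pred V}, GRing.submod_closed S -> S =i pred1 0 \/ S =i predT.

Definition module_isomorphic (B : nzRingType) (V W : lmodType B) : Prop :=
  exists f : {linear V -> W}, bijective f.

(* Isomorphism classes of modules are predicates on lmodType B, as                *)
(* MathComp-Analysis's set and card_eq live in too low a universe for them.       *)
Definition Irr (F : fieldType) (B : falgType F) (c : lmodType B -> Prop) : Prop :=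
  exists V : lmodType B, simple_module V /\ c = @module_isomorphic B V.

Definition has_card (T : Type) (A : T -> Prop) (n : nat) : Prop :=
  exists e : 'I_n -> T,
    (forall i j, e i = e j -> i = j) /\ (forall c, A c <-> exists i, e i = c).

Definition commuting_probability (n : nat) (gT : finGroupType) : rat :=
  #|[set x : {ffun 'I_n -> gT} |
      [forall i, forall j, x i * x j == x j * x i]%g]%SET|%:R / (#|gT| ^ n)%:R.

(* Main.v *)
From HB Require Import structures.
Require Import Defs.
From mathcomp Require Import all_boot all_order all_fingroup all_algebra all_field.
From mathcomp Require Import all_solvable mxrepresentation ring.
From mathcomp Require Import boolp.
From mathcomp Require Import reals complex.

(** Write [delta g] for the idempotent delta_g tensor 1 of D(G). The corner
delta_g D(G) delta_g is spanned by the delta_g tensor x with x in the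
centralizer C(g), so it is the group algebra of C(g); also
delta_g D(G) delta_h = 0 unless g and h are conjugate, and conjugate g and h
give idempotents generating the same two-sided ideal. Hence simple
D(G)-modules correspond to pairs of a conjugacy class [g] and an irreducible
representation of C(g), and a group has as many of the latter as it has
conjugacy classes.

The correspondence is carried by idempotents rather than by induced modules.
For every pair ([g], i) let e be the element of the corner at g on which the
i-th irreducible representation of C(g) takes a diagonal matrix unit as value,
the others vanishing. These idempotents satisfy e D(G) e = F e, are
mutually orthogonal in the strong sense e D(G) e' = 0, and generate D(G) as a
two-sided ideal. For such a family in any algebra A, the left ideals A e form a
complete irredundant list of the simple modules ([card_Irr_idempotents]),
because Hom(A e, V) = e V. The required properties of the e's are
consequences of the Wedderburn decomposition of the group algebra of C(g), in
the form that an element is determined by its images under the irreducible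
representations ([irr_group_mx_inj]), which can be prescribed independently
([irr_group_mx_surj]). All of this holds over any algebraically closed field
whose characteristic does not divide the order of G
([card_Irr_drinfeld_double]).

The second equality is a double application of the orbit-counting formula:
a group H has |H| k(H) commuting pairs, so the commuting triples of G number
the sum over g of |C(g)| k(C(g)); the summand depends only on the class of g,
and grouping by classes leaves |G| times the sum of the k(C(g))
([card_commuting_triples]). *)

Set Implicit Arguments.
Unset Strict Implicit.
Unset Printing Implicit Defensive.

Import GroupScope GRing.Theory.
Local Open Scope ring_scope.

(** * Simple modules over an algebra with enough primitive idempotents *)

Section ModuleIsomorphism.
Variable B : nzRingType.
Implicit Types V W U : lmodType B.

Lemma bij_module_isomorphic V W (f : {linear V -> W}) :
  injective f -> (forall w, exists v, f v = w) -> module_isomorphic V W.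
Proof.
move=> inj_f surj_f; exists f.
have surj_fb w : exists v, f v == w by have [v <-] := surj_f w; exists v.
have gK : cancel (fun w => xchoose (surj_fb w)) f.
  by move=> w; apply/eqP/(xchooseP (surj_fb w)).
by exists (fun w => xchoose (surj_fb w)) => // v; apply/inj_f/gK.
Qed.

Lemma module_isomorphic_refl V : module_isomorphic V V.
Proof. by exists (idfun : {linear V -> V}); exists id. Qed.

Lemma module_isomorphic_sym V W : module_isomorphic V W -> module_isomorphic W V.
Proof.
case=> f [g fK gK].
have lin_g : linear g.
  by move=> a u v; apply: (can_inj fK); rewrite linearP !gK.
pose gL : {linear W -> V} :=
  HB.pack g (GRing.isLinear.Build B W V *:%R g lin_g).
by exists gL; exists f.
Qed.

Lemma module_isomorphic_trans U V W :
  module_isomorphic U V -> module_isomorphic V W -> module_isomorphic U W.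
Proof.
by case=> f bij_f [g bij_g]; exists (g \o f : {linear U -> W}); apply: bij_comp.
Qed.

Lemma module_isomorphic_eq V W :
  module_isomorphic V W -> @module_isomorphic B V = @module_isomorphic B W.
Proof.
move=> isoVW; apply/funext => U; apply/propext; split.
  exact/module_isomorphic_trans/module_isomorphic_sym.
exact: module_isomorphic_trans.
Qed.

Lemma simple_module_schur V W (f : {linear V -> W}) :
    simple_module V -> simple_module W -> (exists v, f v != 0) ->
  module_isomorphic V W.
Proof.
move=> [_ simV] [_ simW] [v nz_fv]; apply: (@bij_module_isomorphic _ _ f).
  have /simV [ker0 | kerT] : GRing.submod_closed [pred u | f u == 0].
  - split=> [|a u w]; rewrite !inE ?linear0 // => /eqP fu0 /eqP fw0.
    by rewrite linearP fu0 fw0 scaler0 addr0.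
  - apply: raddf_inj => u fu0; have := ker0 u.
    by rewrite !inE fu0 eqxx => /esym/eqP.
  by have := kerT v; rewrite !inE (negPf nz_fv).
have /simW [im0 | imT] : GRing.submod_closed [pred w | `[< exists u, f u = w >]].
- split=> [|a u w]; rewrite !inE; first by apply/asboolP; exists 0; rewrite linear0.
  move=> /asboolP[u' <-] /asboolP[w' <-]; apply/asboolP.
  by exists (a *: u' + w'); rewrite linearP.
- by have := im0 (f v); rewrite !inE (negPf nz_fv) => /asboolP[]; exists v.
by move=> w; have := imT w; rewrite !inE => /asboolP.
Qed.

End ModuleIsomorphism.

Section LeftIdeal.
Variables (A : nzRingType) (e : A).

(** The left ideal generated by [e] when [e] is idempotent; being cut out by an
equation, it is a decidable predicate. *)
Definition fixed_by : pred A^o := [pred u : A | u * e == u].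

Lemma fixed_by_submod_closed : GRing.submod_closed fixed_by.
Proof.
split=> [|a u v]; rewrite !inE ?mul0r // => /eqP ue /eqP ve.
by rewrite mulrDl [a *: u]/(a * u) -mulrA ue ve.
Qed.

HB.instance Definition _ :=
  GRing.isSubmodClosed.Build A A^o fixed_by fixed_by_submod_closed.

Record left_ideal := LeftIdeal {left_ideal_val : A^o; _ : left_ideal_val \in fixed_by}.

HB.instance Definition _ := [isSub of left_ideal for left_ideal_val].
HB.instance Definition _ := [Choice of left_ideal by <:].
HB.instance Definition _ := [SubChoice_isSubLmodule of left_ideal by <:].

(** The same map as [val], typed so that products of its values are taken in [A]
rather than in the regular module. *)
Definition elt (u : left_ideal) : A := left_ideal_val u.

Lemma left_idealP (u : left_ideal) : elt u * e = elt u.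
Proof. by case: u => u /=; rewrite inE => /eqP. Qed.

End LeftIdeal.

Definition two_sided_ideal (A : nzRingType) (I : A -> Prop) : Prop :=
  [/\ I 0, forall a b, I a -> I b -> I (a + b),
      forall a b, I b -> I (a * b) & forall a b, I a -> I (a * b)].

Section PrimitiveIdempotents.
Variables (F : fieldType) (A : falgType F) (J : finType) (e : J -> A).

Hypotheses (e_neq0 : forall j, e j != 0) (e_idem : forall j, e j * e j = e j).
Hypothesis e_local : forall j a, exists c : F, e j * a * e j = c *: e j.
Hypothesis e_orth : forall i j a, i != j -> e i * a * e j = 0.
Hypothesis e_full : forall I : A -> Prop,
  two_sided_ideal I -> (forall j, I (e j)) -> I 1.

(** The elements [b] with [b A v = 0] form a two-sided ideal. *)
Lemma faithful_idempotents (V : lmodType A) (v : V) :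
  (forall j a, e j *: (a *: v) = 0) -> v = 0.
Proof.
move=> ev0; suffices: forall a : A, (1 : A) *: (a *: v) = 0.
  by move=> /(_ 1); rewrite !scale1r.
apply: (e_full (I := fun b => forall a, b *: (a *: v) = 0)) => //.
split=> [a | b b' Ib Ib' a | b b' Ib' a | b b' Ib a].
- by rewrite scale0r.
- by rewrite scalerDl Ib Ib' addr0.
- by rewrite -scalerA Ib' scaler0.
- by rewrite -scalerA [b' *: _]scalerA Ib.
Qed.

Definition generator j : left_ideal (e j) :=
  @LeftIdeal A (e j) (e j) (introT eqP (e_idem j)).

(** A nonzero [u] in [A e_j] is not annihilated by all [e_i A]; since
[u = u e_j], orthogonality forces [i = j], and then [e_j a u] is a nonzero
multiple of [e_j], which thus lies in the submodule generated by [u]. *)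
Lemma left_ideal_simple j : simple_module (left_ideal (e j)).
Proof.
split; first by exists (generator j); rewrite -val_eqE /= e_neq0.
move=> S [S0 Slin].
have SZ a u : u \in S -> a *: u \in S.
  by move=> Su; rewrite -[_ *: _]addr0 Slin.
case: (pselect (exists2 u, u \in S & u != 0)) => [[u Su nz_u] | S_triv]; [right | left]; last first.
  move=> u; rewrite !inE; apply/idP/eqP=> [Su | -> //].
  by apply: contra_notP S_triv => /eqP; exists u.
have [[i [a nz_eau]] | no] := pselect (exists i a, e i * a * elt u != 0); last first.
  case/eqP: nz_u; apply: val_inj; apply: (@faithful_idempotents A^o) => i a.
  by apply: contra_notP no => /eqP; exists i, a; rewrite -mulrA.
have Dj : i = j.
  apply: contraNeq nz_eau => ne_ij.
  by rewrite -(left_idealP u) mulrA -[_ * a * _]mulrA e_orth.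
move: nz_eau; rewrite {i}Dj => nz_eau.
have [c Dc] := e_local j (a * elt u).
rewrite mulrA -mulrA left_idealP in Dc.
have nz_c : c != 0 by apply: contraNneq nz_eau => c0; rewrite Dc c0 scale0r.
have Sgen : generator j \in S.
  have Dej : c^-1 *: (e j * a) * elt u = e j.
    by rewrite -scalerAl Dc scalerA mulVf // scale1r.
  suffices ->: generator j = (c^-1 *: (e j * a) : A) *: u by apply: SZ.
  by apply: val_inj; apply/esym/Dej.
move=> w; rewrite [RHS]/= inE; suffices ->: w = elt w *: generator j by apply: SZ.
by apply: val_inj; apply/esym/left_idealP.
Qed.

(** A linear map out of [A e_i] is determined by the image of [e_i], and here
that image lies in [e_i A e_j]. *)
Lemma left_ideal_iso_inj i j :
  module_isomorphic (left_ideal (e i)) (left_ideal (e j)) -> i = j.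
Proof.
case=> f /bij_inj inj_f; apply/eqP; apply: contraT => ne_ij.
have fgen0 : f (generator i) = 0.
  have -> : generator i = e i *: generator i.
    by apply: val_inj; apply/esym/e_idem.
  have := e_orth (elt (f (generator i))) ne_ij; rewrite -mulrA left_idealP => ef0.
  by apply: val_inj; rewrite linearZ; apply: ef0.
have /eqP := inj_f _ _ (etrans fgen0 (esym (linear0 f))).
by rewrite -val_eqE /= (negPf (e_neq0 i)).
Qed.

(** Some [e_j] has a nonzero value [e_j w] in [V], and [u |-> u w] is then a
nonzero map from [A e_j] to [V]. *)
Lemma simple_module_left_ideal (V : lmodType A) :
  simple_module V -> exists j, module_isomorphic (left_ideal (e j)) V.
Proof.
move=> simV; have [[v nz_v] _] := simV.
have [[j [a nz_eav]] | no] := pselect (exists j a, e j *: (a *: v) != 0); last first.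
  case/eqP: nz_v; apply: faithful_idempotents => j a.
  by apply: contra_notP no => /eqP; exists j, a.
pose f (u : left_ideal (e j)) := elt u *: (a *: v).
have lin_f : linear f.
  move=> b u w; transitivity ((b * elt u + elt w) *: (a *: v)); first by [].
  by rewrite scalerDl -scalerA.
pose fL : {linear left_ideal (e j) -> V} :=
  HB.pack f (GRing.isLinear.Build A _ V *:%R f lin_f).
exists j; apply: (@simple_module_schur _ _ _ fL) => //; first exact: left_ideal_simple.
by exists (generator j).
Qed.

Theorem card_Irr_idempotents : has_card (@Irr F A) #|J|.
Proof.
exists (fun k => @module_isomorphic A (left_ideal (e (enum_val k)))).
split=> [i j eq_ij | c].
  apply/enum_val_inj/left_ideal_iso_inj.
  by rewrite eq_ij; apply: module_isomorphic_refl.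
split=> [[V [simV ->]] | [k <-]].
  have [j isoj] := simple_module_left_ideal simV.
  by exists (enum_rank j); rewrite enum_rankK; apply: module_isomorphic_eq.
exists (left_ideal (e (enum_val k))); split=> //; exact: left_ideal_simple.
Qed.

End PrimitiveIdempotents.

(** * Wedderburn components of a group algebra *)

Section GroupMx.
Variables (F : fieldType) (gT : finGroupType) (G : {group gT}).
Local Notation aG := (regular_repr F G).

(** The value of [rG] at the element of the group algebra with coefficient
function [f]. *)
Definition group_mx n (rG : mx_representation F G n) (f : gT -> F) : 'M[F]_n :=
  \sum_(x in G) f x *: rG x.

Lemma gring_op_group_mx n (rG : mx_representation F G n) f :
  gring_op rG (group_mx aG f) = group_mx rG f.
Proof.
rewrite linear_sum; apply: eq_bigr => x Gx.
by rewrite linearZ /= gring_opG.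
Qed.

Lemma mem_group_mx f : (group_mx aG f \in group_ring F G)%MS.
Proof. by apply/envelop_mxP; exists f. Qed.

End GroupMx.

Section GroupAlgebra.
Variables (F : closedFieldType) (gT : finGroupType) (G : {group gT}).
Hypothesis F'G : [pchar F]^'.-group G.
Variable sG : irrType F G.
Local Notation aG := (regular_repr F G).

(** Semisimplicity of the group algebra: the component of an element in each
Wedderburn ideal is determined by its image in the matching representation. *)
Lemma irr_group_mx_inj f :
  (forall i : sG, group_mx (irr_repr i) f = 0) -> {in G, forall x, f x = 0}.
Proof.
move=> irr0; have A0 : group_mx aG f = 0.
  rewrite -[LHS]mulmx1 -(Wedderburn_sum_id_pchar sG F'G) mulmx_sumr big1 // => i _.
  have irr_i : mx_irreducible (irr_repr i) by apply: socle_irr.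
  have Re := Wedderburn_id_mem i.
  have Re' : (Wedderburn_id i \in group_ring F G)%MS.
    by rewrite -(Wedderburn_sum_pchar sG F'G) (sumsmx_sup i).
  have inj_op := @regular_op_inj_pchar _ _ _ sG F'G _ _ irr_i.
  rewrite (irr_reprK_pchar F'G) in inj_op.
  apply: inj_op; rewrite ?inE ?linear0 ?sub0mx //.
    have /andP[idl _] := Wedderburn_ideal i.
    by rewrite (memmx_subP idl) // mem_mulsmx ?mem_group_mx.
  by rewrite gring_opM // gring_op_group_mx irr0 mul0mx.
move=> x Gx; have /(congr1 (gring_proj x)) := A0.
rewrite linear0 linear_sum (bigD1 x) //= big1 => [|y /andP[Gy ne_yx]].
  rewrite linearZ /= gring_projE // eqxx addr0 => /matrixP/(_ 0 0).
  by rewrite !mxE mulr1.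
by rewrite linearZ /= gring_projE // eq_sym (negPf ne_yx) scaler0.
Qed.

(** By absolute irreducibility some element has the image [M]; multiplying it by
the Wedderburn idempotent of [i] kills its other images. *)
Lemma irr_group_mx_surj (i : sG) (M : 'M_(irr_degree i)) : exists f,
  group_mx (irr_repr i) f = M /\
  forall j : sG, j != i -> group_mx (irr_repr j) f = 0.
Proof.
have := group_closure_closed_field (F := F) (socle_irr i).
case/mx_abs_irrP=> _ [a_ DM].
pose B := group_mx aG (a_^~ M) *m Wedderburn_id i.
have Re := Wedderburn_id_mem i.
have Re' : (Wedderburn_id i \in group_ring F G)%MS.
  by rewrite -(Wedderburn_sum_pchar sG F'G) (sumsmx_sup i).
have RB : (B \in Wedderburn_subring i)%MS.
  have /andP[idl _] := Wedderburn_ideal i.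
  by rewrite (memmx_subP idl) // mem_mulsmx ?mem_group_mx.
have /envelop_mxP[f Df] : (B \in group_ring F G)%MS.
  by rewrite -(Wedderburn_sum_pchar sG F'G) (sumsmx_sup i).
exists f; split=> [|j ne_ji].
  rewrite -gring_op_group_mx -[group_mx _ _]Df gring_opM // gring_op_group_mx.
  by rewrite op_Wedderburn_id_pchar // mulmx1; apply/esym/DM.
rewrite -gring_op_group_mx -[group_mx _ _]Df.
by apply: (irr_repr'_op0_pchar F'G _ RB); rewrite eq_sym.
Qed.

End GroupAlgebra.

(** * Corners of the Drinfeld double *)

Section DoubleCorners.
Variables (F : fieldType) (gT : finGroupType).
Local Notation D := (drinfeld_double F gT).
Local Notation delta g := (dd_basis F g 1%g).
Implicit Types (g h x y : gT) (a b d : D).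

Lemma dd_ind (P : D -> Prop) : P 0 -> (forall a b, P a -> P b -> P (a + b)) ->
  (forall c a, P a -> P (c *: a)) -> (forall g x, P (dd_basis F g x)) -> forall a, P a.
Proof.
move=> P0 PD PZ Pb a; rewrite (dd_expand a).
by elim/big_ind: _ => // -[g x] _; apply: PZ.
Qed.

Lemma delta_mul_basis g h x : delta g * dd_basis F h x = (g == h)%:R *: dd_basis F h x.
Proof.
rewrite dd_basisM !mul1g invg1 mulg1.
by case: eqP => [-> | _]; rewrite ?scale0r.
Qed.

Lemma basis_mul_delta g h x :
  dd_basis F h x * delta g = (h == x * g * x^-1)%g%:R *: dd_basis F h x.
Proof. by rewrite dd_basisM mulg1. Qed.

Lemma delta_idem g : delta g * delta g = delta g.
Proof. by rewrite delta_mul_basis eqxx scale1r. Qed.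

Lemma conj_cent1 g x : (g == x * g * x^-1)%g = (x \in 'C[g]).
Proof.
apply/eqP/cent1P => [Dg | ->]; last by rewrite mulgK.
by rewrite /commute {2}Dg mulgKV.
Qed.

(** In [delta_g (delta_k tensor x) delta_h] only [k = g = x h x^-1] contributes. *)
Lemma delta_mul_delta0 g h a :
  (forall x, g != x * h * x^-1)%g -> delta g * a * delta h = 0.
Proof.
move=> not_conj; elim/dd_ind: a => [|a b IHa IHb|c a IHa|k x].
- by rewrite mulr0 mul0r.
- by rewrite mulrDr mulrDl IHa IHb addr0.
- by rewrite -scalerAr -scalerAl IHa scaler0.
rewrite delta_mul_basis; have [<- | _] := eqVneq g k; last first.
  by rewrite scale0r mul0r.
by rewrite scale1r basis_mul_delta (negPf (not_conj x)) scale0r.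
Qed.

Lemma delta_conj g x : dd_basis F (x * g * x^-1)%g x * delta g * dd_basis F g x^-1%g
  = delta (x * g * x^-1)%g.
Proof.
by rewrite basis_mul_delta eqxx scale1r dd_basisM eqxx scale1r mulgV.
Qed.

Lemma dd_oneE : 1 = \sum_g delta g :> D.
Proof. by []. Qed.

Definition in_corner g d := delta g * d * delta g = d.

Lemma corner_deltal g d : in_corner g d -> delta g * d = d.
Proof. by move=> <-; rewrite !mulrA delta_idem. Qed.

Lemma corner_deltar g d : in_corner g d -> d * delta g = d.
Proof. by move=> <-; rewrite -!mulrA delta_idem. Qed.

Lemma in_cornerM g a b d : in_corner g a -> in_corner g b -> in_corner g (a * d * b).
Proof.
move=> <- <-; rewrite /in_corner.
by rewrite !mulrA delta_idem -!mulrA delta_idem.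
Qed.

Section CornerRepresentation.
Variables (g : gT) (n : nat) (rho : mx_representation F 'C[g]%G n).

(** The value of [rho] at the component of [d] in the corner at [g]. *)
Definition dd_op d : 'M[F]_n := group_mx rho (fun x => d (g, x)).

Fact dd_op_linear : linear dd_op.
Proof.
move=> c a b; rewrite /dd_op /group_mx scaler_sumr -big_split /=.
by apply: eq_bigr => x _; rewrite !ffunE scalerDl scalerA.
Qed.

HB.instance Definition _ := GRing.isLinear.Build F D 'M[F]_n *:%R dd_op dd_op_linear.

Lemma dd_op_basis h x :
  dd_op (dd_basis F h x) = if (h == g) && (x \in 'C[g]) then rho x else 0.
Proof.
rewrite /dd_op /group_mx.
have [-> /= | ne_hg] := eqVneq h g; last first.
  by apply: big1 => y _; rewrite dd_basisE xpair_eqE eq_sym (negPf ne_hg) scale0r.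
case: ifP => Cx; last first.
  apply: big1 => y Cy; rewrite dd_basisE xpair_eqE eqxx.
  by case: eqP => [Dy | _]; [rewrite -Dy Cy in Cx | rewrite scale0r].
rewrite (bigD1 x) //= dd_basisE eqxx scale1r big1 ?addr0 // => y /andP[_ ne_yx].
by rewrite dd_basisE xpair_eqE eqxx (negPf ne_yx) scale0r.
Qed.

Lemma dd_op_delta : dd_op (delta g) = 1%:M.
Proof. by rewrite dd_op_basis eqxx group1 repr_mx1. Qed.

(** [dd_op] is not multiplicative on the whole algebra, only across a factor
[delta g]; in particular it is multiplicative on the corner. *)
Lemma dd_opM a b : dd_op (a * delta g * b) = dd_op a *m dd_op b.
Proof.
elim/dd_ind: a => [|a a' IHa IHa'|c a IHa|h x].
- by rewrite !mul0r linear0 mul0mx.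
- by rewrite !mulrDl !linearD /= mulmxDl IHa IHa'.
- by rewrite -!scalerAl !linearZ /= IHa -scalemxAl.
elim/dd_ind: b => [|b b' IHb IHb'|c b IHb|k y].
- by rewrite mulr0 linear0 mulmx0.
- by rewrite mulrDr !linearD /= ?mulmxDr IHb IHb'.
- by rewrite -scalerAr !linearZ /= IHb ?scalemxAr.
rewrite basis_mul_delta -scalerAl dd_basisM !linearZ /= !dd_op_basis.
have [-> /= | _] := eqVneq h g; last by rewrite !scaler0 mul0mx.
rewrite conj_cent1; have [Cx | _] := boolP (x \in 'C[g]); last by rewrite scale0r mul0mx.
have -> : (g == x * k * x^-1)%g = (k == g).
  rewrite {1}(eqP (etrans (conj_cent1 g x) Cx)) eq_sym.
  by rewrite (inj_eq (mulIg _)) (inj_eq (mulgI _)).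
rewrite scale1r groupMl //; case: eqP => _ /=; last by rewrite scale0r mulmx0.
by rewrite scale1r; case: ifP => Cy; rewrite ?mulmx0 // repr_mxM.
Qed.

Lemma dd_op_corner d : dd_op (delta g * d * delta g) = dd_op d.
Proof.
have -> : delta g * d * delta g = delta g * delta g * (d * delta g * delta g).
  by rewrite delta_idem -[d * _ * _]mulrA delta_idem mulrA.
by rewrite !dd_opM dd_op_delta mul1mx mulmx1.
Qed.

Lemma dd_op_cornerM a d b : in_corner g a -> in_corner g b ->
  dd_op (a * d * b) = dd_op a *m dd_op d *m dd_op b.
Proof.
move=> Ca Cb; rewrite -(corner_deltar Ca) -{1}(corner_deltal Cb).
by rewrite mulrA !dd_opM corner_deltar.
Qed.

End CornerRepresentation.

End DoubleCorners.

Lemma delta_mx_local (R : comNzRingType) n (A : 'M[R]_n) (p : 'I_n) :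
  delta_mx p p *m A *m delta_mx p p = A p p *: delta_mx p p.
Proof.
apply/matrixP=> r s; rewrite mxE (bigD1 p) //= big1 => [|t /negPf ne_tp].
  rewrite addr0 mxE (bigD1 p) //= big1 => [|t /negPf ne_tp].
    rewrite addr0 !mxE !eqxx andbT /=.
    by case: (r == p); case: (s == p); rewrite /= ?mul1r ?mul0r ?mulr0.
  by rewrite mxE ne_tp andbF mul0r.
by rewrite [delta_mx _ _ t s]mxE ne_tp mulr0.
Qed.

(** * Simple modules of the Drinfeld double *)

Section DoubleIrreducibles.
Variables (F : closedFieldType) (gT : finGroupType).
Hypothesis F'G : [pchar F]^'.-group [set: gT].
Local Notation D := (drinfeld_double F gT).
Local Notation delta g := (dd_basis F g 1%g).
Implicit Types (g h x y : gT) (a b d : D).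

Let F'C g : [pchar F]^'.-group 'C[g]%G := pgroupS (subsetT _) F'G.

Section OneCorner.
Variables (g : gT) (sG : irrType F 'C[g]%G).

(** The corner is isomorphic to the group algebra of the centralizer, so its
elements are separated by the irreducible representations. *)
Lemma corner_eq a b : in_corner g a -> in_corner g b ->
  (forall i : sG, dd_op (irr_repr i) a = dd_op (irr_repr i) b) -> a = b.
Proof.
move=> Ca Cb eq_ab; apply/eqP; rewrite -subr_eq0 -Ca -Cb -mulrBl -mulrBr.
have ab0 := irr_group_mx_inj (F'C g) (sG := sG) (f := fun x => (a - b) (g, x)) _.
rewrite (dd_expand (a - b)) mulr_sumr mulr_suml big1 // => -[h x] _.
rewrite -scalerAr -scalerAl /= delta_mul_basis.
have [<- | _] := eqVneq g h; last by rewrite scale0r mul0r scaler0.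
rewrite scale1r basis_mul_delta conj_cent1.
have [Cx | _] := boolP (x \in _); last by rewrite scale0r scaler0.
rewrite ab0 ?scale0r // => i.
by rewrite -[LHS]/(dd_op (irr_repr i) (a - b)) linearB /= eq_ab subrr.
Qed.

(** [d] is the element of the corner whose Wedderburn components are [M] at [i]
and [0] elsewhere. *)
Definition corner_lift (i : sG) (M : 'M_(irr_degree i)) d : Prop :=
  [/\ in_corner g d, dd_op (irr_repr i) d = M
    & forall j : sG, j != i -> dd_op (irr_repr j) d = 0].

Lemma corner_lift_exists (i : sG) (M : 'M_(irr_degree i)) :
  exists d, corner_lift M d.
Proof.
have [f [fi fj]] := irr_group_mx_surj (F'C g) M.
pose d : D := [ffun p => if p.1 == g then f p.2 else 0].
have op_d (j : sG) : dd_op (irr_repr j) d = group_mx (irr_repr j) f.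
  by apply: eq_bigr => x _; rewrite ffunE eqxx.
exists (delta g * d * delta g); split=> [||j ne_ji]; rewrite ?dd_op_corner ?op_d ?fi ?fj //.
by rewrite /in_corner !mulrA delta_idem -!mulrA delta_idem.
Qed.

Lemma corner_lift_uniq (i : sG) (M : 'M_(irr_degree i)) a b :
  corner_lift M a -> corner_lift M b -> a = b.
Proof.
move=> [Ca ai a0] [Cb bi b0]; apply: corner_eq => // j.
by have [-> | ne_ji] := eqVneq j i; rewrite ?ai ?bi // a0 ?b0.
Qed.

Lemma corner_lift0 (i : sG) : corner_lift (0 : 'M_(irr_degree i)) 0.
Proof.
by split=> [||j _]; rewrite ?linear0 // /in_corner mulr0 mul0r.
Qed.

Lemma corner_liftD (i : sG) (M N : 'M_(irr_degree i)) a b :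
  corner_lift M a -> corner_lift N b -> corner_lift (M + N) (a + b).
Proof.
move=> [Ca ai a0] [Cb bi b0]; split=> [||j ne_ji].
- by rewrite /in_corner mulrDr mulrDl Ca Cb.
- by rewrite linearD /= ai bi.
by rewrite linearD /= a0 // b0 // addr0.
Qed.

Lemma corner_liftZ (i : sG) (M : 'M_(irr_degree i)) c a :
  corner_lift M a -> corner_lift (c *: M) (c *: a).
Proof.
move=> [Ca ai a0]; split=> [||j ne_ji].
- by rewrite /in_corner -scalerAr -scalerAl Ca.
- by rewrite linearZ /= ai.
by rewrite linearZ /= a0 // scaler0.
Qed.

Lemma corner_liftM (i : sG) (M N : 'M_(irr_degree i)) a d b :
    corner_lift M a -> corner_lift N b ->
  corner_lift (M *m dd_op (irr_repr i) d *m N) (a * d * b).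
Proof.
move=> [Ca ai a0] [Cb bi b0]; split=> [||j ne_ji]; first exact: in_cornerM.
  by rewrite dd_op_cornerM // ai bi.
by rewrite dd_op_cornerM // a0 // !mul0mx.
Qed.

Lemma corner_lift_orth (i j : sG) (M : 'M_(irr_degree i))
    (N : 'M_(irr_degree j)) a d b :
  i != j -> corner_lift M a -> corner_lift N b -> a * d * b = 0.
Proof.
move=> ne_ij [Ca ai a0] [Cb bj b0]; apply: corner_eq => [||l].
- exact: in_cornerM.
- by rewrite /in_corner mulr0 mul0r.
rewrite linear0 dd_op_cornerM //.
have [-> | ne_li] := eqVneq l i; first by rewrite b0 // mulmx0.
by rewrite a0 // !mul0mx.
Qed.

(** Conjugating the matrix unit [e i] by other matrix units of the corner gives
all diagonal matrix units at [i], and the sum of these over all [i] is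
[delta g], the identity of the corner. *)
Lemma delta_in_ideal (I : D -> Prop) (p : forall i : sG, 'I_(irr_degree i))
    (e : sG -> D) :
    two_sided_ideal I -> (forall i, I (e i)) ->
    (forall i, corner_lift (delta_mx (p i) (p i)) (e i)) ->
  I (delta g).
Proof.
move=> [I0 ID IMl IMr] Ie eP.
have ideal_unit (i : sG) :
    exists2 d, I d & corner_lift (1%:M : 'M_(irr_degree i)) d.
  (* Matrix units multiply as E_kp E_pp E_pk = E_kk. *)
  rewrite mx1_sum_delta; elim/big_ind: _ => [|M N [a Ia aP] [b Ib bP]|k _].
  - by exists 0 => //; apply: corner_lift0.
  - by exists (a + b); [apply: ID | apply: corner_liftD].
  have [u uP] := corner_lift_exists (delta_mx k (p i)).
  have [v vP] := corner_lift_exists (delta_mx (p i) k).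
  exists (u * e i * v); first exact/IMr/IMl.
  have [_ ei _] := eP i; have := corner_liftM (e i) uP vP.
  by rewrite ei !mul_delta_mx.
have /boolp.choice[z zP] : forall i : sG, exists d,
    I d /\ corner_lift (1%:M : 'M_(irr_degree i)) d.
  by move=> i; have [d Id dP] := ideal_unit i; exists d.
have -> : delta g = \sum_i z i.
  apply: corner_eq => [||l].
  - by rewrite /in_corner !delta_idem.
  - rewrite /in_corner mulr_sumr mulr_suml; apply: eq_bigr => i _.
    by have [_ []] := zP i.
  rewrite dd_op_delta linear_sum (bigD1 l) //= big1 => [|i ne_il].
    by have [_ [_ -> _]] := zP l; rewrite addr0.
  by have [_ [_ _]] := zP i; apply; rewrite eq_sym.
by elim/big_ind: _ => // i _; have [] := zP i.
Qed.

End OneCorner.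

Definition irr_centralizer g : irrType F 'C[g]%G :=
  DecSocleType (regular_repr F 'C[g]%G).

Definition conj_class : finType := {xG : {set gT} | xG \in classes [set: gT]}.

Definition double_index : finType :=
  {c : conj_class & irr_centralizer (repr (val c))}.

Lemma card_double_index :
  #|double_index| = (\sum_(xG in classes [set: gT]) #|classes 'C[repr xG]|)%N.
Proof.
rewrite card_tagged sumnE big_map big_enum /= [RHS]big_sub.
apply: eq_bigr => xG _; rewrite card_irr_pchar //.
exact: group_closure_closed_field.
Qed.

(** The hypotheses of [card_Irr_idempotents] hold for diagonal matrix units, one
in each Wedderburn component of each corner: the component gives locality and
orthogonality within a corner, non-conjugacy gives orthogonality between
corners, and the ideal they generate contains every [delta h] because [delta h]
is a conjugate of [delta g] for the representative [g] of its class. *)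
Theorem card_Irr_drinfeld_double : has_card (@Irr F D) #|double_index|.
Proof.
pose pivot g (i : irr_centralizer g) := Ordinal (irr_degree_gt0 i).
have /boolp.choice[e eP] (j : double_index) :=
  corner_lift_exists (delta_mx (pivot _ (tagged j)) (pivot _ (tagged j))).
have e_corner c i : in_corner (repr (val c)) (e (existT _ c i)).
  by have [] := eP (existT _ c i).
have e_opE c i : dd_op (irr_repr i) (e (existT _ c i)) = delta_mx (pivot _ i) (pivot _ i).
  by have [] := eP (existT _ c i).
apply: (@card_Irr_idempotents F D _ e).
- move=> [c i]; apply: contraTneq isT => e0; have := e_opE c i.
  move/matrixP/(_ (pivot _ i) (pivot _ i))/eqP.
  by rewrite e0 linear0 !mxE !eqxx eq_sym oner_eq0.
- move=> [c i]; rewrite -{1}(corner_deltar (e_corner c i)).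
  have eij := eP (existT _ c i); have := corner_liftM (delta (repr (val c))) eij eij.
  rewrite dd_op_delta mulmx1 mul_delta_mx => ee.
  exact: corner_lift_uniq ee eij.
- move=> [c i] a; exists (dd_op (irr_repr i) a (pivot _ i) (pivot _ i)).
  apply: (corner_lift_uniq (corner_liftM a (eP _) (eP _))).
  by rewrite delta_mx_local; apply/corner_liftZ/eP.
- move=> [c i] [c' i'] a; have [Dc | ne_c _] := eqVneq c c'.
    case: c' / Dc i' => i' ne_ii'.
    apply: (corner_lift_orth a _ (eP (existT _ c i)) (eP (existT _ c i'))).
    by apply: contraNneq ne_ii' => /= ->.
  rewrite -(corner_deltar (e_corner c i)) -(corner_deltal (e_corner c' i')).
  rewrite mulrA -[_ * _ * a]mulrA -[_ * (_ * _) * _]mulrA.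
  rewrite [X in e _ * X * _]delta_mul_delta0 ?mulr0 ?mul0r // => x.
  apply: contraNneq ne_c => Dc; apply/eqP/val_inj.
  have /repr_classesP[_ ->] := valP c; have /repr_classesP[_ ->] := valP c'.
  by rewrite Dc -{1}(invgK x) -mulgA -conjgE classGidl ?inE.
move=> I idealI Ie; have [I0 ID IMl IMr] := idealI.
have Idelta (c : conj_class) : I (delta (repr (val c))).
  apply: (delta_in_ideal idealI _ (fun i => eP (existT _ c i))) => i.
  exact: Ie.
rewrite dd_oneE; elim/big_ind: _ => // h _.
have [x _ Dr] := repr_class [set: gT] h.
pose c : conj_class := exist _ (h ^: [set: gT]) (mem_classes (in_setT h)).
have := Idelta c; rewrite /= Dr => Ihx.
have -> : delta h =
    dd_basis F (x * (h ^ x) * x^-1)%g x * delta (h ^ x)%g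
      * dd_basis F (h ^ x)%g x^-1%g.
  by rewrite delta_conj conjgE !mulgA mulgV mul1g mulgK.
exact/IMr/IMl.
Qed.

End DoubleIrreducibles.

(** * Commuting triples *)

Section Counting.
Variable gT : finGroupType.
Implicit Types (G H : {group gT}).

(** Orbit counting for the conjugation action of [H] on itself, where the fixed
points of [a] are its centralizer. *)
Lemma card_commuting_pairs H :
  (\sum_(a in H) #|'C_H[a]| = #|classes H| * #|H|)%N.
Proof.
have actsH : [acts H, on H | 'J] by rewrite astabsJ normG.
rewrite -(Frobenius_Cauchy actsH); apply: eq_bigr => a _.
congr #|pred_of_set _|; apply/setP=> x; rewrite in_setI [RHS]in_setI; congr (_ && _).
by apply/cent1P/afix1P => [/commgP/conjg_fixP | /conjg_fixP/commgP].
Qed.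

Lemma nclasses_cent1J (x y : gT) : #|classes 'C[x ^ y]| = #|classes 'C[x]|.
Proof.
have -> : 'C[x ^ y] = conjgm [set: gT] y @* 'C[x].
  by rewrite morphimEsub ?subsetT // cent1J.
by apply: nclasses_injm; rewrite ?injm_conj ?subsetT.
Qed.

Lemma card_commuting_triples :
  (#|[set x : {ffun 'I_3 -> gT} |
      [forall i, forall j, x i * x j == x j * x i]%g]|
   = #|gT| * \sum_(xG in classes [set: gT]) #|classes 'C[repr xG]|)%N.
Proof.
transitivity (\sum_(g : gT) \sum_(a in 'C[g]) #|'C_('C[g])[a]|)%N.
  pose tr (x : {ffun 'I_3 -> gT}) := (x 0, x 1, x (2%:R)).
  pose ofn (p : gT * gT * gT) : {ffun 'I_3 -> gT} :=
    [ffun i : 'I_3 => nth 1%g [:: p.1.1; p.1.2; p.2] i].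
  have ofnK : cancel ofn tr by case=> [[a b] c]; rewrite /tr !ffunE.
  have trK : cancel tr ofn.
    move=> x; apply/ffunP=> i; rewrite ffunE /tr.
    by case: i => [[|[|[|]]]] //= lt_i; congr (x _); apply: val_inj.
  under [RHS]eq_bigr do under eq_bigr do rewrite -sum1_card.
  under [RHS]eq_bigr do rewrite pair_big_dep.
  rewrite pair_big_dep -sum1_card (reindex (fun p => ofn (p.1, p.2.1, p.2.2))) /=; last first.
    exists (fun x => ((tr x).1.1, ((tr x).1.2, (tr x).2))) => [[a [b c]] _ | x _].
      by rewrite ofnK.
    exact: trK.
  apply: eq_bigl => -[a [b c]]; rewrite [LHS]inE in_setI /=.
  apply/forallP/idP=> [comm | /and3P[]].
    have co i j := eqP (forallP (comm i) j).
    have := (co 0 1, co 0 2%:R, co 1 2%:R); rewrite !ffunE /= => -[[ab ac] bc].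
    by apply/and3P; split; apply/cent1P/esym.
  move=> /cent1P/esym ab /cent1P/esym ac /cent1P/esym bc i; apply/forallP=> j.
  rewrite !ffunE; apply/eqP.
  by case: i => [[|[|[|]]]] //= _; case: j => [[|[|[|]]]] //= _.
transitivity (\sum_(g : gT) #|classes 'C[g]| * #|'C[g]|)%N.
  by apply: eq_bigr => g _; apply: card_commuting_pairs.
rewrite (eq_bigl [in [set: gT]]) => [|g]; last by rewrite inE.
rewrite (set_partition_big _ (classes_partition [set: gT])) big_distrr /=.
apply: eq_bigr => _ /imsetP[x _ ->].
have [y _ Dr] := repr_class [set: gT] x.
rewrite Dr nclasses_cent1J.
rewrite (eq_bigr (fun=> #|classes 'C[x]| * #|'C[x]|)%N) => [|_ /imsetP[z _ ->]]; last first.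
  by rewrite nclasses_cent1J cent1J cardJg.
rewrite sum_nat_const -index_cent1 setTI -(cardsT gT).
by rewrite -(Lagrange (subsetT 'C[x])) mulnCA mulnC [(#|_| * _)%N in LHS]mulnC.
Qed.

Lemma commuting_probability3 :
  #|gT|%:R ^+ 2 * commuting_probability 3 gT
  = (\sum_(xG in classes [set: gT]) #|classes 'C[repr xG]|)%:R :> rat.
Proof.
have nz_G : #|gT|%:R != 0 :> rat by rewrite Num.Theory.pnatr_eq0 -lt0n -cardsT cardG_gt0.
rewrite /commuting_probability card_commuting_triples natrX natrM.
by field.
Qed.

End Counting.

(** * The three counts *)

Theorem theorem4p5 (R : realType) (gT : finGroupType) :
  let n := (\sum_(xG in classes [set: gT]) #|classes 'C[repr xG]|)%N in
  has_card (@Irr _ (drinfeld_double R[i] gT)) n /\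
  n%:R = #|gT|%:R ^+ 2 * commuting_probability 3 gT.
Proof.
move=> n; split; last by rewrite commuting_probability3.
have F'G : [pchar R[i]]^'.-group [set: gT].
  by apply/pgroupP=> p _ _; rewrite inE /= Num.Theory.pchar_num.
rewrite /n -(card_double_index F'G).
exact: card_Irr_drinfeld_double.
Qed.
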